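(* Let $G$ be any finite simple graph. Then \[ \left|I(G;-1)\right| \le \min_{D\in \Phi_3(G)} \left|\mathrm{Ind}(G[D])\right| \le 2^{\phi_3(G)}. \]
   Context: For a finite simple graph $G$, the independence polynomial is $I(G;x)=\sum_{k\ge 0} i_k(G)x^k$, where $i_k(G)$ is the number of independent sets of $G$ of size $k$ (with $i_0(G)=1$, counting the empty set). A $\tilde{3}$-cycle is a cycle whose length is divisible by $3$. A graph is called ternary if it contains no induced $\tilde{3}$-cycle. A set $D\subseteq V(G)$ is a $\tilde{3}$-decycling set of $G$ if $G-D$ is ternary; $\Phi_3(G)$ denotes the set of all $\tilde{3}$-decycling sets of $G$, and $\phi_3(G)$ is the minimum size of a $\tilde{3}$-decycling set of $G$. For $D\subseteq V(G)$, $G[D]$ is the subgraph of $G$ induced by $D$. For a graph $H$, $\mathrm{Ind}(H)$ is the independence complex of $H$, i.e., the family of all independent sets of $H$ (including the empty set), so $\left|\mathrm{Ind}(H)\right|$ is the total number of independent sets of $H$. *)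

(* Defs.v *)
(* A finite simple graph is a symmetric irreflexive
   relation e : rel T on a finType T (vertex set = T). *)
From mathcomp Require Import all_boot all_order all_algebra.
Set Implicit Arguments. Unset Strict Implicit. Unset Printing Implicit Defensive.
Import GRing.Theory Num.Theory.

Section Graph.
Variables (T : finType) (e : rel T).

Definition independent (S : {set T}) : bool :=
  [forall x in S, forall y in S, ~~ e x y].

Definition indep_poly : {poly int} :=
  \sum_(S : {set T} | independent S) 'X^#|S|.

Definition cyc_adj (k : nat) (i j : 'I_k) : bool :=
  (nat_of_ord j == i.+1 %% k) || (nat_of_ord i == j.+1 %% k).

Definition induced_cycle (k : nat) (f : {ffun 'I_k -> T}) : bool :=
  (3 <= k) && injectiveb f && [forall i, forall j, e (f i) (f j) == cyc_adj i j].

(* G - D is ternary: no induced cycle of G - D (i.e. an induced cycle of G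
   avoiding D) has length divisible by 3.  Lengths are bounded by #|T|
   since the cycle vertices are distinct. *)
Definition ternary_minus (D : {set T}) : bool :=
  ~~ [exists n : 'I_#|T|.+1, exists f : {ffun 'I_n -> T},
        [&& 3 %| n, induced_cycle f & [forall i, f i \notin D]]].

Definition decycling (D : {set T}) : bool := ternary_minus D.

Definition ind_count (D : {set T}) : nat :=
  #|[set S : {set T} | (S \subset D) && independent S]|.

(* phi_3(G) = min size of a decycling set (setT is decycling, so the
   default #|T| is attained/harmless). *)
Definition phi3 : nat := \big[minn/#|T|]_(D : {set T} | decycling D) #|D|.

(* min over D in Phi_3(G) of |Ind(G[D])| (default 2^#|T| is an upper bound
   of every ind_count, and Phi_3(G) is nonempty). *)
Definition min_ind_decycling : nat :=
  \big[minn/2 ^ #|T|]_(D : {set T} | decycling D) ind_count D.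

End Graph.

(* Main.v *)
(* Write I(G) for the independence complex of G.  Removing a vertex v gives a
   cofibre sequence I(G - N[v]) -> I(G - v) -> I(G).  We track a formal dimension
   idim: Some d stands for "homology of a (d-1)-sphere", None for "acyclic", and a
   set of vertices is good when these dimensions fit into all the cofibre sequences
   of its subsets; then I(G;-1) is 0 or +-1.

   Let V be ternary and minimal not good.  Then V behaves as if I(V) had two
   homology classes, in dimensions i and j, and each v is present in one class and
   absent in the other.  If i <> j, this 2-colours V, and deleting the
   neighbourhood of a vertex of a suitable class leaves an isolated vertex, against
   the dimension count for monochromatic sets.  If i = j, the relation idim (V - u - v) <> None is an equivalence;
   any two edges meet a common class, so there are exactly three classes, and every
   vertex has neighbours in both other classes.  Orienting the edges cyclically
   along the three classes, a shortest directed cycle is induced (a chord in either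
   direction shortens it) and has length divisible by 3, a contradiction.

   Finally the vertices of a decycling set D are deleted one at a time:
   f(G) = f(G - v) - f(G - N[v]) is the recursion of |Ind(G[D])| up to the sign. *)

Require Import Defs.
From mathcomp Require Import all_boot all_order all_algebra.
From mathcomp Require Import zify.
Set Implicit Arguments. Unset Strict Implicit. Unset Printing Implicit Defensive.
Import Order.TTheory GRing.Theory Num.Theory.

(** * Preliminaries: minima and the arithmetic of dimensions *)

Lemma bigminn_le_cond (I : eqType) (r : seq I) (P : pred I) (F : I -> nat) k i :
  i \in r -> P i -> \big[minn/k]_(j <- r | P j) F j <= F i.
Proof.
elim: r => //= j r IHr; rewrite inE big_cons => /predU1P[<- ->|ir Pi].
  exact: geq_minl.
by case: ifP => _; [apply: leq_trans (geq_minr _ _) _|]; apply: IHr.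
Qed.

(** Dimension of a mapping cone, with [y] for I(G - v) and [z] for I(G - N[v]). Two spheres give
    [None], which is right only for an equivalence; [compat] rules out the other case. *)
Definition cone (y z : option nat) : option nat :=
  match y, z with
  | Some d, None => Some d
  | None, Some d => Some d.+1
  | _, _ => None
  end.

(* The triples of dimensions allowed for I(G), I(G - v), I(G - N[v]).  When both
   I(G - v) and I(G - N[v]) are spheres, they must have the same dimension and the
   map between them is an equivalence. *)
Definition compat (x y z : option nat) : Prop :=
  x = cone y z /\
  match y, z with Some d, Some d' => d = d' | _, _ => True end.

Lemma compat_dec x y z : compat x y z \/ ~ compat x y z.
Proof.
rewrite /compat; have [->|nx] := x =P cone y z; last by right=> -[].
by case: y z => [d|] [d'|]; [have [->|dd'] := d =P d'; [left|right=> -[]]|left..].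
Qed.

(** The join of spheres of dimensions a - 1 and b - 1 has dimension a + b - 1, so the shifted
    dimensions add. *)
Definition join (y z : option nat) : option nat :=
  match y, z with Some d, Some d' => Some (d + d') | _, _ => None end.

Lemma joinC (x y : option nat) : join x y = join y x.
Proof. by case: x y => [d|] [d'|] //=; rewrite addnC. Qed.

Lemma compat_join x y z u : compat x y z ->
  compat (join x u) (join y u) (join z u).
Proof.
by case: y z u => [d|] [d'|] [k|] [-> /= E]; rewrite /compat /= ?addSn ?E.
Qed.

(** The value of I(G;-1) when I(G) is a (d-1)-sphere: minus its reduced Euler characteristic. *)
Definition dim_sign (x : option nat) : int :=
  if x is Some d then (-1) ^+ d else 0.

Lemma dim_sign_compat x y z : compat x y z -> dim_sign x = (dim_sign y - dim_sign z)%R.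
Proof.
case: y z => [d|] [d'|] [-> /=]; rewrite ?subrr ?subr0 ?sub0r //.
  by move=> ->; rewrite subrr.
by rewrite exprS mulN1r.
Qed.

Lemma dim_sign_cases x : [\/ dim_sign x = 0, dim_sign x = 1 | dim_sign x = -1]%R.
Proof.
case: x => [d|] /=; last by constructor 1.
by rewrite -signr_odd; case: odd; rewrite ?expr1 ?expr0; [constructor 3|constructor 2].
Qed.

Ltac option_cases := rewrite /compat /=; intuition (try congruence);
  repeat match goal with H : Some _ = Some _ |- _ => injection H; clear H; intro end;
  try congruence; try lia.

(** * Shortest directed cycles *)

Lemma third_color (i j k : nat) : i < 3 -> j < 3 -> k < 3 -> i != j -> i != k -> j != k ->
  j != i.+1 %% 3 -> k = i.+1 %% 3.
Proof. lia. Qed.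

Section Cycle.
Variables (T : finType) (e : rel T).
Hypothesis e_sym : symmetric e.
Variables (V : {set T}) (c : T -> nat).
Hypotheses (c_lt3 : forall x, c x < 3)
  (c_proper : forall x y, x \in V -> y \in V -> e x y -> c x != c y)
  (c_next : forall x, x \in V ->
     exists y, [/\ y \in V, e x y & c y = (c x).+1 %% 3]).

Definition arc x y := [&& x \in V, y \in V, e x y & c y == (c x).+1 %% 3].

Lemma edge_arc x y : x \in V -> y \in V -> e x y -> arc x y || arc y x.
Proof.
move=> xV yV exy; rewrite /arc xV yV exy e_sym exy /=.
by have := c_proper xV yV exy; have := c_lt3 x; have := c_lt3 y; lia.
Qed.

Lemma path_color x s : path arc x s -> c (last x s) = (c x + size s) %% 3.
Proof.
elim: s x => [|y s IHs] x /=; first by rewrite addn0 modn_small.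
by case/andP=> /and4P[_ _ _ /eqP cy] /IHs->; rewrite cy; lia.
Qed.

(** Every vertex of [V] has an outgoing arc, so following chosen arcs must eventually revisit a
    vertex. *)
Lemma cycle_exists : V != set0 -> exists2 p, p != [::] & cycle arc p.
Proof.
case/set0Pn=> x xV.
pose g y := odflt y [pick z | arc y z].
have gP y : y \in V -> arc y (g y).
  move=> yV; rewrite /g; case: pickP => //= no; have [z [zV eyz cz]] := c_next yV.
  by have := no z; rewrite /arc yV zV eyz cz eqxx.
have gV y : y \in V -> g y \in V by move/gP/and4P=> [].
have pathg k y : y \in V -> path arc y (traject g (g y) k).
  by elim: k y => //= k IHk y yV; rewrite gP // IHk ?gV.
have /trajectP[i lt_i E] := looping_order g x.
set y := iter i g x; have yV : y \in V.
  by rewrite /y; elim: (i) => [|j IHj] //; rewrite iterS; apply: gV.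
pose k := (order g x - i).-1.
have yk : iter k.+1 g y = y by rewrite /y -iterD -E; congr (iter _ g x); rewrite /k; lia.
exists (y :: traject g (g y) k) => //=.
have := pathg k.+1 y yV; rewrite trajectSr; congr (path arc y (rcons _ _)).
by rewrite -iterSr.
Qed.

Lemma next_nth_uniq (p : seq T) x0 i : uniq p -> i < size p ->
  next p (nth x0 p i) = nth x0 p (i.+1 %% size p).
Proof.
move=> Up ip; rewrite next_nth mem_nth // index_uniq //.
case: p Up ip => //= z p _; rewrite ltnS leq_eqVlt => /predU1P[->|ip].
  by rewrite modnn nth_default.
by rewrite modn_small //=; apply: set_nth_default.
Qed.

Lemma induced_directed_cycle : V != set0 ->
  exists n, exists f : {ffun 'I_n -> T},
    [/\ 3 %| n, induced_cycle e f & forall i, f i \in V].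
Proof.
move=> V0.
(* The successor excludes the empty list, which is trivially a cycle. *)
pose P n := [exists t : n.+1.-tuple T, cycle arc t].
have exP : exists n, P n.
  have [p] := cycle_exists V0; case: p => // x s _ cp.
  by exists (size s); apply/existsP; exists (in_tuple (x :: s)).
case: (ex_minnP exP) => n /existsP[[p /= /eqP sp] cp] minn.
have short q : q != [::] -> cycle arc q -> n < size q.
  case: q => // x s _ cq; apply: minn; apply/existsP.
  by exists (in_tuple (x :: s)).
have Vp x : x \in p -> x \in V.
  by move=> xp; have /and4P[] := next_cycle cp xp.
(* The stretch between two occurrences of a vertex would be a shorter closed walk. *)
have Up : uniq p.
  apply/negPn/negP=> nUp.
  case: p sp cp nUp {Vp} => // x0 s0; set p := x0 :: s0 => sp cp.
  case/(uniqPn x0)=> i [j [lt_ij lt_j Eij]].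
  have := cp; rewrite -(rot_cycle i) /rot (drop_nth x0) ?(ltn_trans lt_ij) // cat_cons.
  set x := nth x0 p i; set s := _ ++ _ => cs.
  have xs : x \in s.
    rewrite mem_cat; apply/orP; left; rewrite /x Eij.
    rewrite -(subnKC lt_ij) -nth_drop mem_nth // size_drop; lia.
  have : size s = n.
    by have := size_rot i p; rewrite sp /rot (drop_nth x0) ?(ltn_trans lt_ij) //= => -[].
  case/splitPr: xs cs => s1 s2; rewrite /= rcons_cat cat_path => /andP[ps1 /= /andP[ax _]].
  have : n < size (x :: s1) by apply: short => //=; rewrite rcons_path ps1.
  by rewrite size_cat /=; lia.
(* An arc from [x] to [y] closes the segment of [p] running from [y] to [x]. By minimality that
   segment is all of [p], so [y] already follows [x]. *)
have arc_next x y : x \in p -> y \in p -> arc x y -> next p x = y.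
  move=> xp yp xy; have [i s E] := rot_to yp.
  have := cp; rewrite -(rot_cycle i) E => cs.
  have xs : x \in y :: s by rewrite -E mem_rot.
  suff lx : last y s = x.
    rewrite -[RHS](next_prev Up) -(prev_rot i Up) E prev_nth inE eqxx /=.
    have ys : y \notin s by have := Up; rewrite -(rot_uniq i) E => /andP[].
    by rewrite memNindex // -last_nth lx.
  case/splitPl: xs cs E => s1 s2 lx cs E.
  have : n < size (y :: s1).
    apply: short => //=; rewrite rcons_path lx xy andbT.
    by move: cs; rewrite /= rcons_cat cat_path => /andP[].
  have := size_rot i p; rewrite E sp /= size_cat.
  case: s2 {E cs} => [|z s2] /=; last by lia.
  by rewrite cats0.
(* Each arc raises the colour by one modulo 3, and the walk returns to its initial colour. *)
have sp3 : 3 %| n.+1.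
  case: p cp sp {short minn Vp Up arc_next} => // x s cp /= sp.
  have := path_color cp; rewrite last_rcons size_rcons sp.
  have := c_lt3 x; lia.
have x0 : T by case: (p) sp => [|x].
exists n.+1, [ffun i : 'I_n.+1 => nth x0 p i].
have pi (i : 'I_n.+1) : i < size p by rewrite sp ltn_ord.
split => //; last by move=> i; rewrite ffunE Vp // mem_nth.
apply/andP; split; first (apply/andP; split).
- by case: (n) sp3 => [|[|k]].
- by apply/injectiveP=> i j; rewrite !ffunE => /eqP; rewrite nth_uniq // => /eqP/val_inj.
apply/forallP=> i; apply/forallP=> j; rewrite !ffunE /cyc_adj.
have nextE (k l : 'I_n.+1) :
    (next p (nth x0 p k) == nth x0 p l) = (l == k.+1 %% n.+1 :> nat).
  by rewrite next_nth_uniq // sp nth_uniq // ?sp ?ltn_mod // eq_sym.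
have step (k l : 'I_n.+1) : l == k.+1 %% n.+1 :> nat -> e (nth x0 p k) (nth x0 p l).
  by rewrite -nextE => /eqP<-; have /and4P[] := next_cycle cp (mem_nth x0 (pi k)).
apply/eqP; apply/idP/idP.
  move=> eij; have [ip jp] := (mem_nth x0 (pi i), mem_nth x0 (pi j)).
  have /orP[/(arc_next _ _ ip jp)|/(arc_next _ _ jp ip)] := edge_arc (Vp _ ip) (Vp _ jp) eij.
    by move/eqP; rewrite nextE => ->.
  by move/eqP; rewrite nextE => ->; rewrite orbT.
by case/orP=> /step //; rewrite e_sym.
Qed.
End Cycle.

(** * Dimensions of independence complexes *)

Section Graph.
Variables (T : finType) (e : rel T).
Hypotheses (e_sym : symmetric e) (e_irr : irreflexive e).
Implicit Types (A B C D S V : {set T}) (u v w x y z : T).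

Definition cnbh v : {set T} := [set u | (u == v) || e v u].
Local Notation N := cnbh.

(** The complex whose only face is empty is the (-1)-sphere, hence [Some 0]. The vertex is an
    arbitrary choice of [pick]; goodness makes every other choice give the same value. *)
Fixpoint idim_rec n A : option nat :=
  if n is n'.+1 then
    if [pick v in A] is Some v then cone (idim_rec n' (A :\ v)) (idim_rec n' (A :\: N v))
    else Some 0
  else Some 0.

Definition idim A := idim_rec #|A| A.

Lemma mem_cnbh v : v \in N v. Proof. by rewrite inE eqxx. Qed.

Lemma card_rem v A : v \in A -> #|A :\ v| < #|A|.
Proof. by move=> vA; rewrite [X in _ < X](cardsD1 v) vA. Qed.

Lemma subDN v A : A :\: N v \subset A :\ v.
Proof. by apply: setDS; rewrite sub1set mem_cnbh. Qed.

Lemma card_remN v A : v \in A -> #|A :\: N v| < #|A|.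
Proof. by move=> vA; apply: leq_ltn_trans (card_rem vA); exact: subset_leq_card (subDN _ _). Qed.

Lemma idim_rec_enough n m A : #|A| <= n -> #|A| <= m -> idim_rec n A = idim_rec m A.
Proof.
elim: n m A => [|n IHn] m A.
  rewrite leqn0 cards_eq0 => /eqP-> _; case: m => //= m.
  by case: pickP => // v; rewrite inE.
case: m => [|m] An.
  by rewrite leqn0 cards_eq0 => /eqP-> /=; case: pickP => // v; rewrite inE.
move=> Am /=; case: pickP => // v vA.
by congr cone; apply: IHn; rewrite -ltnS;
  [apply: leq_trans (card_rem vA) _ | apply: leq_trans (card_rem vA) _
  |apply: leq_trans (card_remN vA) _ | apply: leq_trans (card_remN vA) _].
Qed.

Lemma idim0 : idim set0 = Some 0. Proof. by rewrite /idim cards0. Qed.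

Lemma idim_pick A : A != set0 ->
  exists2 v, v \in A & idim A = cone (idim (A :\ v)) (idim (A :\: N v)).
Proof.
case/set0Pn=> x xA; rewrite /idim.
have: #|A| = #|A|.-1.+1 by rewrite prednK // card_gt0; apply/set0Pn; exists x.
move=> E; rewrite E /=; case: pickP => [v vA|/(_ x)]; last by rewrite xA.
exists v => //; congr cone; apply: idim_rec_enough => //.
  by rewrite -ltnS -E card_rem.
by rewrite -ltnS -E card_remN.
Qed.

Definition compat_at A v := compat (idim A) (idim (A :\ v)) (idim (A :\: N v)).

Definition good V := forall A v, A \subset V -> v \in A -> compat_at A v.

Lemma goodS A V : A \subset V -> good V -> good A.
Proof. by move=> AV gV B v BA; apply: gV; apply: subset_trans AV. Qed.

Definition separated A B := forall x y, x \in A -> y \in B -> (x != y) && ~~ e x y.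

Lemma separatedC A B : separated A B -> separated B A.
Proof. by move=> sep x y xB yA; rewrite eq_sym e_sym sep. Qed.

Lemma separatedSl A A' B : A' \subset A -> separated A B -> separated A' B.
Proof. by move=> /subsetP sA sep x y /sA; apply: sep. Qed.

Lemma separatedU_rem A B v : separated A B -> v \in A ->
  (A :|: B) :\ v = (A :\ v) :|: B /\ (A :|: B) :\: N v = (A :\: N v) :|: B.
Proof.
move=> sep vA; split; apply/setP=> x; rewrite !inE.
  case: eqP => [->|] //=.
  by apply/esym/negP=> vB; have := sep _ _ vA vB; rewrite eqxx.
case: (boolP (x \in B)) => [xB|]; last by rewrite !orbF.
by rewrite !orbT andbT negb_or eq_sym; exact: sep.
Qed.

(** The independence complex of a union without cross edges is a join. Joining with a fixed complex
    preserves [compat], so it suffices to expand at the picked vertex, inside the part that contains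
    it. *)
Lemma idim_join A B : good A -> good B -> separated A B ->
  idim (A :|: B) = join (idim A) (idim B).
Proof.
move: {2}#|A :|: B| (leqnn #|A :|: B|) => n.
elim: n A B => [|n IHn] A B; first rewrite leqn0 cards_eq0 setU_eq0.
  by move=> /andP[/eqP-> /eqP->] _ _ _; rewrite setU0 idim0.
move=> leAB gA gB sep.
have [E|/idim_pick[v vAB ->]] := eqVneq (A :|: B) set0.
  by have /eqP := E; rewrite setU_eq0 => /andP[/eqP-> /eqP->]; rewrite setU0 idim0.
wlog vA : A B leAB gA gB sep vAB / v \in A.
  move=> W; case/setUP: (vAB) => [|vB]; first exact: W.
  rewrite setUC W //; first exact: joinC.
  - by rewrite setUC.
  - exact: separatedC.
  - by rewrite setUC.
have [E1 E2] := separatedU_rem sep vA.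
rewrite E1 E2 !IHn //.
- by have [-> _] := compat_join (idim B) (gA A v (subxx _) vA).
- by rewrite -E2 -ltnS; apply: leq_trans leAB; apply: card_remN.
- by apply: goodS gA; rewrite subsetDl.
- by apply: separatedSl sep; rewrite subsetDl.
- by rewrite -E1 -ltnS; apply: leq_trans leAB; apply: card_rem.
- by apply: goodS gA; rewrite subsetDl.
- by apply: separatedSl sep; rewrite subsetDl.
Qed.

Lemma setDAC A B C : A :\: B :\: C = A :\: C :\: B.
Proof. by rewrite !setDDl setUC. Qed.

Lemma rem_comm A u v : A :\ u :\ v = A :\ v :\ u.
Proof. by rewrite setDAC. Qed.

Lemma remN_comm A u v : A :\ u :\: N v = A :\: N v :\ u.
Proof. by rewrite setDAC. Qed.

Lemma remN_adj A u v : e u v -> A :\ u :\: N v = A :\: N v.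
Proof.
move=> uv; rewrite setDDl; congr (_ :\: _); apply/setUidPr.
by rewrite sub1set inE e_sym uv orbT.
Qed.

Lemma mem_remN A u v : u != v -> ~~ e u v -> u \in A -> u \in A :\: N v.
Proof. by move=> uv nuv uA; rewrite !inE negb_or uv e_sym nuv. Qed.

(* Otherwise deleting q first would give idim A = Some l, and deleting p first
   would give Some (l + 2). *)
Lemma good_rem_rem A p q : good A -> p \in A -> q \in A -> p != q ->
  idim A != None -> idim (A :\ p) = None -> idim (A :\ q) != None ->
  idim (A :\ p :\ q) = None.
Proof.
move=> gA pA qA pq.
have qAp : q \in A :\ p by rewrite !inE eq_sym pq.
have pAq : p \in A :\ q by rewrite !inE pq.
have := gA _ _ (subxx _) pA; have := gA _ _ (subxx _) qA.
have := gA _ _ (subsetDl _ _) qAp; have := gA _ _ (subsetDl _ _) pAq.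
rewrite /compat_at (rem_comm A q p) (remN_comm A q p) (remN_comm A p q).
(* For adjacent [p] and [q], deleting one before the closed neighbourhood of the other changes
   nothing: four relations remain between six dimensions. *)
have [pqe|npqe] := boolP (e p q).
  rewrite -!remN_comm (remN_adj A pqe) (remN_adj A (etrans (e_sym q p) pqe)).
  rewrite /compat.
  by case: (idim A) => [?|] //; case: (idim (A :\ p)) => [?|]; case: (idim (A :\ q)) => [?|] //;
    case: (idim (A :\ p :\ q)) => [?|] //=; case: (idim (A :\: N p)) => [?|] //=;
    case: (idim (A :\: N q)) => [?|] //=; intuition congruence.
(* Otherwise two more relations are available, sharing the dimension of [A :\: N p :\: N q]. *)
have pAq' : p \in A :\: N q by apply: mem_remN.
have qAp' : q \in A :\: N p by apply: mem_remN; rewrite // 1?eq_sym 1?e_sym.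
have := gA _ _ (subsetDl _ _) pAq'; have := gA _ _ (subsetDl _ _) qAp'.
rewrite /compat_at (setDAC A (N q) (N p)) /compat.
by case: (idim A) => [?|] //; case: (idim (A :\ p)) => [?|]; case: (idim (A :\ q)) => [?|] //;
    case: (idim (A :\ p :\ q)) => [?|] //=; case: (idim (A :\: N p)) => [?|] //=;
    case: (idim (A :\: N q)) => [?|] //=; case: (idim (A :\: N p :\ q)) => [?|] //=;
    case: (idim (A :\: N q :\ p)) => [?|] //=; case: (idim (A :\: N p :\: N q)) => [?|] //=;
    option_cases.
Qed.

(** * Weighted counts of independent sets *)

Definition ind_sum (w : int) A : int :=
  \sum_(S : {set T} | (S \subset A) && independent e S) w ^+ #|S|.

Lemma independentP S :
  reflect (forall x y, x \in S -> y \in S -> ~~ e x y) (independent e S).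
Proof.
apply: (iffP forall_inP) => [H x y xS yS|H x xS].
  by have /forall_inP := H x xS; apply.
by apply/forall_inP=> y; apply: H.
Qed.

Lemma independentU1 v S : independent e (v |: S) =
  independent e S && (S \subset [set x | ~~ e v x]).
Proof.
apply/independentP/andP=> [H|[/independentP iS /subsetP sS] x y].
  split; first by apply/independentP=> x y xS yS; apply: H; rewrite !inE (xS, yS) orbT.
  by apply/subsetP=> x xS; rewrite inE; apply: H; rewrite !inE ?eqxx ?xS ?orbT.
case/setU1P=> [->|xS] /setU1P[->|yS]; rewrite ?e_irr //.
- by have := sS _ yS; rewrite inE.
- by have := sS _ xS; rewrite inE e_sym.
exact: iS.
Qed.

(** Independent sets containing [v] correspond to those of [A :\: N v], each gaining a factor
    [w]. *)
Lemma ind_sum_rec (w : int) A v : v \in A ->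
  ind_sum w A = (ind_sum w (A :\ v) + w * ind_sum w (A :\: N v))%R.
Proof.
move=> vA; rewrite /ind_sum (bigID (fun S : {set T} => v \in S)) /= addrC; congr (_ + _)%R.
  by apply: eq_bigl => S; rewrite subsetD1 -!andbA; congr (_ && _); rewrite andbC.
rewrite mulr_sumr (reindex_onto (fun S => v |: S) (fun S => S :\ v)) /=; last first.
  by move=> S /andP[_ vS]; rewrite setD1K.
apply: eq_big => [S|S].
  rewrite independentU1 setU11 andbT subUset sub1set vA /=.
  have [vS|vS] := boolP (v \in S).
    have -> : (S \subset A :\: N v) = false.
      by apply/negP=> /subsetP/(_ _ vS); rewrite !inE eqxx.
    by apply/negP=> /andP[_ /eqP E]; move: vS; rewrite -E !inE eqxx.
  have -> : (v |: S) :\ v = S by rewrite setU1K.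
  rewrite eqxx andbT andbA andbAC; congr (_ && _).
  apply/andP/subsetP=> [[/subsetP sA /subsetP sN] x xS|sD].
    have := sN x xS; rewrite !inE (sA x xS) andbT negb_or => ->; rewrite andbT.
    by apply: contraNneq vS => <-.
  by split; apply/subsetP=> x /sD; rewrite !inE negb_or => /andP[/andP[_ ?]].
case/andP=> _ /eqP E; rewrite cardsU1; suff -> : v \notin S by rewrite exprS.
by rewrite -E !inE eqxx.
Qed.

Lemma ind_sum0 (w : int) : ind_sum w set0 = 1%R.
Proof.
rewrite /ind_sum (big_pred1 set0) ?cards0 // => S.
rewrite subset0 /=; case: eqP => [->|] //=.
by apply/independentP=> x y; rewrite inE.
Qed.

Lemma ind_sum_good A : good A -> ind_sum (-1) A = dim_sign (idim A).
Proof.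
move: {2}#|A| (leqnn #|A|) => n; elim: n A => [|n IHn] A.
  by rewrite leqn0 cards_eq0 => /eqP-> _; rewrite ind_sum0 idim0.
move=> An gA; have [->|/set0Pn[v vA]] := eqVneq A set0; first by rewrite ind_sum0 idim0.
rewrite (ind_sum_rec _ vA) !IHn ?(dim_sign_compat (gA _ _ (subxx _) vA)) ?mulN1r //.
- by rewrite -ltnS; apply: leq_trans (card_remN vA) An.
- by apply: goodS gA; rewrite subsetDl.
- by rewrite -ltnS; apply: leq_trans (card_rem vA) An.
- by apply: goodS gA; rewrite subsetDl.
Qed.

(** No independent set contains both ends of an edge, so this is inclusion-exclusion over the end
    avoided. *)
Lemma ind_sum_edge (w : int) A x y : x \in A -> y \in A -> e x y ->
  (ind_sum w (A :\ x :\ y) = ind_sum w (A :\ x) + ind_sum w (A :\ y) - ind_sum w A)%R.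
Proof.
move=> xA yA xy; have nyx : y != x by apply: contraTneq xy => ->; rewrite e_irr.
have yAx : y \in A :\ x by rewrite !inE nyx.
rewrite (ind_sum_rec w yA) (ind_sum_rec w yAx) (remN_adj A xy); lia.
Qed.

(** * Minimal vertex sets with incompatible dimensions *)

Section Bad.
Variable V : {set T}.
Hypothesis propV : forall A v, A \proper V -> v \in A -> compat_at A v.

(** Heuristically, the two classes of I(V) have shifted dimensions [d] and [d'.+1]: the first comes
    from I(V - u), the second from the suspension of I(V - N[u]). *)
Definition dims u d d' := idim (V :\ u) = Some d /\ idim (V :\: N u) = Some d'.

Lemma proper_rem u : u \in V -> V :\ u \proper V.
Proof. exact: properD1. Qed.

Lemma proper_remN u : u \in V -> V :\: N u \proper V.
Proof. by move=> uV; apply: sub_proper_trans (subDN u V) (proper_rem uV). Qed.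

Lemma good_proper A : A \proper V -> good A.
Proof. by move=> AV B v BA; apply: propV; apply: sub_proper_trans AV. Qed.

(** * Relations between two vertices when all proper subsets are compatible *)

Section Pair.
Variables u v : T.
Hypotheses (uV : u \in V) (vV : v \in V) (uv : u != v).

Lemma compat_rem : compat (idim (V :\ u)) (idim (V :\ u :\ v)) (idim (V :\ u :\: N v)).
Proof. by apply: propV; rewrite ?proper_rem // !inE eq_sym uv. Qed.

Lemma compat_remN : ~~ e u v ->
  compat (idim (V :\: N u)) (idim (V :\ v :\: N u)) (idim (V :\: N u :\: N v)).
Proof.
move=> nuv; rewrite remN_comm; apply: propV; rewrite ?proper_remN //.
by apply: mem_remN; rewrite // 1?eq_sym 1?e_sym.
Qed.

End Pair.

(* The first alternative means that u and v lie in different classes: v then has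
   the dimensions of u in exchanged roles. *)
Lemma dims_pair u v d d' k k' : u \in V -> v \in V -> u != v ->
  dims u d d' -> dims v k k' ->
  (idim (V :\ u :\ v) = None /\ k = d'.+1 /\ d = k'.+1) \/
  (idim (V :\ u :\ v) = Some d /\ k = d /\ k' = d' /\ e u v = false).
Proof.
move=> uV vV uv [u1 u2] [v1 v2].
have vu : v != u by rewrite eq_sym.
have := compat_rem uV vV uv; have := compat_rem vV uV vu.
have := compat_remN uV vV uv; have := compat_remN vV uV vu.
rewrite (rem_comm V v u) (setDAC V (N v) (N u)) (e_sym v u).
have [euv|nuv] := boolP (e u v).
  rewrite (remN_adj V euv) (remN_adj V (etrans (e_sym v u) euv)) u1 u2 v1 v2 /compat => _ _.
  by case: (idim (V :\ u :\ v)) => [?|] /=; intuition (try congruence); left; intuition congruence.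
move=> /(_ isT) + /(_ isT); rewrite u1 u2 v1 v2 /compat.
case: (idim (V :\ u :\ v)) => [?|] /=; case: (idim (V :\ v :\: N u)) => [?|] /=;
case: (idim (V :\ u :\: N v)) => [?|] /=; case: (idim (V :\: N u :\: N v)) => [?|] /=;
 intuition (try congruence); (try (left; intuition congruence));  right; intuition congruence.
Qed.

Lemma dims_all w u d d' : w \in V -> u \in V -> dims w d d' -> d <> d' ->
  exists k k', dims u k k'.
Proof.
move=> wV uV [w1 w2] dd'.
have [->|uw] := eqVneq u w; first by exists d, d'.
have wu : w != u by rewrite eq_sym.
have := compat_rem uV wV uw; have := compat_rem wV uV wu.
have := compat_remN uV wV uw; have := compat_remN wV uV wu.
rewrite (rem_comm V w u) (setDAC V (N w) (N u)) (e_sym w u) /dims.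
have [euw|nuw] := boolP (e u w).
  rewrite (remN_adj V euw) (remN_adj V (etrans (e_sym w u) euw)) w1 w2 /compat => _ _.
  case: (idim (V :\ u :\ w)) => [?|] /=; case: (idim (V :\ u)) => [?|] /=;
  by case: (idim (V :\: N u)) => [?|] /=; intuition (try congruence); eexists; eexists.
move=> /(_ isT) + /(_ isT); rewrite w1 w2 /compat.
case: (idim (V :\ u :\ w)) => [?|] /=; case: (idim (V :\ w :\: N u)) => [?|] /=;
case: (idim (V :\ u :\: N w)) => [?|] /=; case: (idim (V :\: N u :\: N w)) => [?|] /=;
 intuition (try congruence); do 2 eexists; split; eassumption.
Qed.

(** Here [x] and [y] are the dimensions of [V] predicted at [u] and at [v]. The relations at
    [V :\ u] and [V :\ v] share [V :\ u :\ v], and the edge reduces their other terms to [V :\: N v]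
    and [V :\: N u]. *)
Lemma edge_agree u v (x y : option nat) : u \in V -> v \in V -> e u v ->
  compat x (idim (V :\ u)) (idim (V :\: N u)) ->
  compat y (idim (V :\ v)) (idim (V :\: N v)) -> x = y.
Proof.
move=> uV vV uv.
have nuv : u != v by apply: contraTneq uv => ->; rewrite e_irr.
have nvu : v != u by rewrite eq_sym.
have := compat_rem uV vV nuv; have := compat_rem vV uV nvu.
rewrite (rem_comm V v u) (remN_adj V uv) (remN_adj V (etrans (e_sym v u) uv)) /compat.
case: (idim (V :\ u :\ v)) => [?|] /=; case: (idim (V :\ u)) => [?|] /=;
case: (idim (V :\ v)) => [?|] /=; case: (idim (V :\: N u)) => [?|] /=;
case: (idim (V :\: N v)) => [?|] /=; option_cases.
Qed.

Lemma cone_joinV A B u : A :|: B = V -> A \proper V -> B \proper V ->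
  separated A B -> u \in A ->
  cone (idim (V :\ u)) (idim (V :\: N u)) = join (idim A) (idim B).
Proof.
move=> defV AV BV sep uA.
have [gA gB] := (good_proper AV, good_proper BV).
have [E1 E2] := separatedU_rem sep uA.
rewrite -defV E1 E2 !idim_join //.
- by have [-> _] := compat_join (idim B) (gA A u (subxx _) uA).
- by apply: goodS gA; rewrite subsetDl.
- by apply: separatedSl sep; rewrite subsetDl.
- by apply: goodS gA; rewrite subsetDl.
- by apply: separatedSl sep; rewrite subsetDl.
Qed.

Definition clash u :=
  if (idim (V :\ u), idim (V :\: N u)) is (Some d, Some d') then d != d' else false.

Lemma clash_compat u : ~~ clash u ->
  compat (cone (idim (V :\ u)) (idim (V :\: N u))) (idim (V :\ u)) (idim (V :\: N u)).
Proof.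
by rewrite /clash /compat; case: (idim (V :\ u)) (idim (V :\: N u)) => [d|] [d'|] //= /negPn/eqP.
Qed.

(** Without a clash every vertex predicts a value of [idim V], constant along edges. Two different
    values would disconnect [V], but then both parts predict the same join. *)
Lemma clash_exists v : v \in V -> ~ compat_at V v -> exists2 w, w \in V & clash w.
Proof.
move=> vV nv.
have [/existsP[w /andP[wV cw]]|/existsPn noc] := boolP [exists w, (w \in V) && clash w].
  by exists w.
have {noc} ok u : u \in V ->
    compat (cone (idim (V :\ u)) (idim (V :\: N u))) (idim (V :\ u)) (idim (V :\: N u)).
  by move=> uV; apply: clash_compat; have := noc u; rewrite uV.
case: nv; pose val u := cone (idim (V :\ u)) (idim (V :\: N u)).
suff valv u : u \in V -> val u = val v.
  have /idim_pick[u uV hV] : V != set0 by apply/set0Pn; exists v.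
  by rewrite /compat_at hV -/(val u) valv //; apply: ok.
pose A := [set u in V | val u == val v]; pose B := V :\: A.
have AB : A :|: B = V by apply/setP=> x; rewrite !inE; case: (x \in V); case: eqP.
have sep : separated A B.
  move=> x y; rewrite !inE => /andP[xV /eqP vx] /andP[+ yV]; rewrite yV /= => vy.
  apply/andP; split; first by apply: contraNneq vy => <-; apply/eqP.
  apply: contra vy => exy; rewrite -vx; apply/eqP.
  by rewrite /val -(edge_agree xV yV exy (ok _ xV) (ok _ yV)).
have vA : v \in A by rewrite inE vV eqxx.
have BV : B \proper V.
  by rewrite properE subsetDl; apply/subsetPn; exists v => //; rewrite inE vA.
move=> uV; have [uA|uA] := boolP (u \in A); first by move: uA; rewrite inE => /andP[_ /eqP].
have uB : u \in B by rewrite inE uA.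
have AV : A \proper V.
  rewrite properE; apply/andP; split; first by apply/subsetP=> x; rewrite inE => /andP[].
  by apply/subsetPn; exists u.
rewrite /val (cone_joinV AB AV BV sep vA) joinC; apply: cone_joinV => //.
  by rewrite setUC.
exact: separatedC.
Qed.

Lemma nonempty_ind (P : {set T} -> Prop) :
  (forall x, P [set x]) ->
  (forall x A, A != set0 -> x \notin A -> P A -> P (x |: A)) ->
  forall A, A != set0 -> P A.
Proof.
move=> P1 PU A; move: {2}#|A| (leqnn #|A|) => n.
elim: n A => [|n IHn] A; first by rewrite leqn0 cards_eq0 => ->.
move=> An /set0Pn[x xA]; rewrite -(setD1K xA).
have [->|nA] := eqVneq (A :\ x) set0; first by rewrite setU0.
apply: PU => //; first by rewrite !inE eqxx.
by apply: IHn => //; rewrite -ltnS; apply: leq_trans (card_rem xA) An.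
Qed.

(** For distinct vertices with known [dims], this selects the second alternative of [dims_pair]: the
    same class. *)
Definition eqv u v := (u == v) || (idim (V :\ u :\ v) != None).

Lemma eqvC u v : eqv u v = eqv v u.
Proof. by rewrite /eqv eq_sym (rem_comm V u v). Qed.

(** * Deleting the vertices of one class *)

Section Class.
Variables (S : {set T}) (d d' : nat).
Hypotheses (SV : S \subset V) (S_dims : forall u, u \in S -> dims u d d').
Hypothesis S_stable : forall u v, u \in S -> v \in S -> ~~ e u v.
Hypothesis S_min : forall B, B \proper S -> B != set0 -> idim (V :\: B) = Some d.

(* The members of A are present and those of B absent. *)
Definition idim_on A B := idim (V :\: (\bigcup_(x in A) N x :|: B)).

Lemma compat_on A B z : A \subset S -> z \in S -> z \notin A -> z \notin B ->
  B \subset S -> (A != set0) || (B != set0) ->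
  compat (idim_on A B) (idim_on A (z |: B)) (idim_on (z |: A) B).
Proof.
move=> AS zS zA zB BS nAB; rewrite /idim_on.
pose C := V :\: (\bigcup_(x in A) N x :|: B).
have zNA : z \notin \bigcup_(x in A) N x.
  apply/bigcupP=> -[x xA]; rewrite inE (negPf (S_stable _ zS)) ?(subsetP AS) // orbF.
  by move/eqP=> zx; move: zA; rewrite zx xA.
have zC : z \in C by rewrite !inE negb_or zNA zB (subsetP SV).
have -> : V :\: (\bigcup_(x in A) N x :|: (z |: B)) = C :\ z.
  by rewrite /C setDDl; congr (_ :\: _); rewrite setUCA setUC.
have -> : V :\: (\bigcup_(x in z |: A) N x :|: B) = C :\: N z.
  by rewrite bigcup_setU big_set1 /C setDDl; congr (_ :\: _); rewrite -setUA setUC.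
apply: propV => //; rewrite properE subsetDl; apply/subsetPn.
case/orP: nAB => /set0Pn[x xX].
  exists x; first by rewrite (subsetP SV) ?(subsetP AS).
  by rewrite !inE negb_and negbK; apply/orP; left; apply/orP; left;
    apply/bigcupP; exists x => //; apply: mem_cnbh.
exists x; first by rewrite (subsetP SV) ?(subsetP BS).
by rewrite !inE xX orbT.
Qed.

Lemma idim_on0 B : idim_on set0 B = idim (V :\: B).
Proof. by rewrite /idim_on big_set0 set0U. Qed.

Lemma idim_on1 x : x \in S -> idim_on [set x] set0 = Some d'.
Proof. by move=> /S_dims[_]; rewrite /idim_on big_set1 setU0. Qed.

(** For one present vertex [x], deleting [B] and deleting [x |: B] both leave dimension [d], so the
    third term is acyclic. Further present vertices keep two acyclic terms, hence a third. *)
Lemma idim_on_mixed A : A != set0 -> forall B, B != set0 ->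
  (forall x, x \in A -> x \notin B) -> A :|: B \proper S -> idim_on A B = None.
Proof.
move: A; apply: nonempty_ind => [x|x A nA xA IHA] B nB dAB ABS.
  have xB : x \notin B by apply: dAB; rewrite inE.
  have [xS BS] : x \in S /\ B \subset S.
    by have := proper_sub ABS; rewrite subUset sub1set => /andP.
  have := @compat_on set0 B x (sub0set _) xS _ xB BS.
  rewrite inE nB orbT setU0 !idim_on0 => /(_ isT isT).
  have BpS : B \proper S by apply: sub_proper_trans ABS; apply: subsetUr.
  rewrite (S_min BpS nB) (S_min ABS); last by apply/set0Pn; exists x; rewrite !inE eqxx.
  by rewrite /compat; case: (idim_on _ B) => [?|] [].
have := proper_sub ABS; rewrite !subUset sub1set => /andP[/andP[xS AS] BS].
have xB : x \notin B by apply: dAB; rewrite !inE eqxx.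
have := compat_on AS xS xA xB BS; rewrite nA => /(_ isT).
rewrite IHA //; last first.
- by apply: sub_proper_trans ABS; apply: setSU; apply: subsetUr.
- by move=> y yA; apply: dAB; rewrite !inE yA orbT.
rewrite (IHA (x |: B)).
- by rewrite /compat; case: (idim_on _ B) => [?|] [].
- by apply/set0Pn; exists x; rewrite !inE eqxx.
- move=> y yA; rewrite !inE negb_or dAB ?andbT; last by rewrite !inE yA orbT.
  by apply: contraNneq xA => <-.
by rewrite setUA (setUC A).
Qed.

(** Failure at [S] makes [V :\: S] acyclic, which settles one present vertex. Turning another absent
    vertex present passes through an acyclic mixed pattern, so the dimension is kept. *)
Lemma idim_on_compl dS : idim (V :\: S) <> Some d -> d = dS.+1 ->
  forall A, A != set0 -> A \proper S -> idim_on A (S :\: A) = Some dS.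
Proof.
move=> tS dE; apply: nonempty_ind => [x|x A nA xA IHA] AS.
  have xS : x \in S by have := proper_sub AS; rewrite sub1set.
  have nSx : S :\ x != set0.
    by case/properP: AS => _ [y yS yx]; apply/set0Pn; exists y; rewrite inE yS yx.
  have := @compat_on set0 (S :\ x) x (sub0set _) xS _ _ (subsetDl _ _).
  rewrite inE nSx !inE eqxx orbT => /(_ isT isT isT).
  rewrite setU0 (setD1K xS) !idim_on0 (S_min (properD1 xS) nSx) dE /compat.
  case: (idim (V :\: S)) tS => [k|] tS; case: (idim_on _ _) => [?|] //=; option_cases.
have := proper_sub AS; rewrite subUset sub1set => /andP[xS AS'].
have xB : x \notin S :\: (x |: A) by rewrite !inE eqxx.
have := compat_on AS' xS xA xB (subsetDl _ _); rewrite nA => /(_ isT).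
have -> : x |: (S :\: (x |: A)) = S :\: A.
  apply/setP=> y; rewrite !inE negb_or; case: eqP => [->|] //=.
  by rewrite xS xA.
have pA : A \proper S by apply: sub_proper_trans AS; apply: subsetUr.
rewrite (IHA pA) idim_on_mixed //.
- by rewrite /compat; case: (idim_on _ _) => [k|] [] // _ ->.
- by case/properP: AS => _ [y yS yx]; apply/set0Pn; exists y; rewrite inE yS yx.
- by move=> y yA; rewrite !inE yA orbT.
apply/properP; split; first by rewrite subUset AS' subsetDl.
by exists x => //; rewrite !inE negb_or xA negb_and negbK eqxx.
Qed.

(** Making [x] absent gives an acyclic mixed pattern, so each further present vertex lowers the
    dimension by one. *)
Lemma idim_on_all A : A != set0 -> A \proper S ->
  exists2 k, idim_on A set0 = Some k & (k + #|A| = d'.+1)%N.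
Proof.
move: A; apply: nonempty_ind => [x|x A nA xA IHA] AS.
  have xS : x \in S by have := proper_sub AS; rewrite sub1set.
  by exists d'; rewrite ?idim_on1 // cards1 addn1.
have := proper_sub AS; rewrite subUset sub1set => /andP[xS AS'].
have := @compat_on A set0 x AS' xS xA _ (sub0set _); rewrite nA inE => /(_ isT isT).
have pA : A \proper S by apply: sub_proper_trans AS; apply: subsetUr.
have [k -> kA] := IHA pA; rewrite setU0 idim_on_mixed //; first last.
- by rewrite setUC.
- by move=> y yA; rewrite !inE; apply: contraNneq xA => <-.
- by apply/set0Pn; exists x; rewrite inE.
rewrite cardsU1 xA /compat.
case: (idim_on (x |: A) set0) => [k'|] [] //= [kk'] _; exists k' => //; lia.
Qed.

(* If S fails, every pattern (A present, S :\: A absent) with A proper and nonempty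
   has the same dimension d - 1; comparing with A of size #|S| - 1, where the
   dimension of "A present" is d' + 1 - #|A|, determines #|S|. *)
Lemma min_failure : (1 < #|S|)%N -> idim (V :\: S) <> Some d -> (d + #|S| = d' + 3)%N.
Proof.
move=> S1 tS.
have /set0Pn[x xS] : S != set0 by rewrite -card_gt0; lia.
have nSx : S :\ x != set0 by rewrite -card_gt0; have := cardsD1 x S; rewrite xS; lia.
(* The relation at [V :\: (S :\ x)] forces [V :\: S] to be acyclic, so [d] is the dimension of a
   suspension. *)
have [dS dE] : exists dS, d = dS.+1.
  have := @compat_on set0 (S :\ x) x (sub0set _) xS _ _ (subsetDl _ _).
  rewrite inE nSx !inE eqxx orbT => /(_ isT isT isT).
  rewrite setU0 (setD1K xS) !idim_on0 (S_min (properD1 xS) nSx) /compat.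
  case: (idim (V :\: S)) tS => [k|] tS; case: (idim_on _ _) => [k'|] //=;
    option_cases; by exists k'.
have pSx := properD1 xS.
have := @compat_on (S :\ x) set0 x (subsetDl _ _) xS _ _ (sub0set _).
rewrite nSx !inE eqxx => /(_ isT isT isT).
have [k -> kE] := idim_on_all nSx pSx.
have -> : x |: set0 = S :\: (S :\ x).
  apply/setP=> y; rewrite !inE orbF; case: eqP => [->|_] /=; first by rewrite xS.
  by case: (y \in S).
rewrite (idim_on_compl tS dE nSx pSx) /compat.
have := cardsD1 x S; rewrite xS; case: (idim_on _ _) => [?|] /=; option_cases.
Qed.

End Class.

(** A minimal failure with more than one vertex satisfies [d + #|S| = d' + 3], so [d' < d] leaves at
    most two vertices. Sizes one and two hold by [dims] and by [eqv]. *)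
Lemma class_deletion S d d' : (d' < d)%N -> S != set0 -> S \subset V ->
  (forall u, u \in S -> dims u d d') ->
  (forall u v, u \in S -> v \in S -> eqv u v) -> idim (V :\: S) = Some d.
Proof.
move=> dd'; move: {2}#|S| (leqnn #|S|) => n.
elim: n S => [|n IHn] S; first by rewrite leqn0 cards_eq0 => ->.
move=> Sn nS SV S_dims S_eqv.
have S_pair u v : u \in S -> v \in S -> u != v ->
    idim (V :\ u :\ v) = Some d /\ e u v = false.
  move=> uS vS uv; have := S_eqv _ _ uS vS; rewrite /eqv (negPf uv) /= => hN.
  have := dims_pair (subsetP SV _ uS) (subsetP SV _ vS) uv (S_dims _ uS) (S_dims _ vS).
  by case=> [[] idim0|[] -> []]; [rewrite idim0 in hN | move=> _ [_]].
have S_stable u v : u \in S -> v \in S -> ~~ e u v.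
  move=> uS vS; have [->|uv] := eqVneq u v; first by rewrite e_irr.
  by have [_ ->] := S_pair _ _ uS vS uv.
have S_min B : B \proper S -> B != set0 -> idim (V :\: B) = Some d.
  move=> BS nB; have sBS := subsetP (proper_sub BS); apply: IHn => //.
  - by rewrite -ltnS; apply: leq_trans (proper_card BS) Sn.
  - exact: subset_trans (proper_sub BS) SV.
  - by move=> u /sBS /S_dims.
  - by move=> u v /sBS uS /sBS vS; apply: S_eqv.
have [//|/eqP tS] := eqVneq (idim (V :\: S)) (Some d).
have [/cards1P[x Sx]|S1] := boolP (#|S| == 1%N).
  by rewrite Sx; have [] := S_dims x; rewrite ?Sx ?inE.
have S_gt0 : (0 < #|S|)%N by rewrite card_gt0.
have [/cards2P exS|S2] := boolP (#|S| == 2%N).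
  have [x [y [xy Sxy]]] := exS; case: tS; rewrite Sxy -setDDl.
  by have [] := S_pair x y _ _ xy; rewrite ?Sxy ?inE ?eqxx ?orbT.
have S_gt1 : (1 < #|S|)%N by lia.
have := min_failure SV S_dims S_stable S_min S_gt1 tS.
lia.
Qed.

Definition nbh v := [set u in V | e v u].

(** Without its neighbours [v] is isolated, so the complex is a cone with apex [v]. *)
Lemma nbh_deletion v : v \in V -> nbh v != set0 -> idim (V :\: nbh v) = None.
Proof.
move=> vV /set0Pn[u uN]; have uV : u \in V by move: uN; rewrite inE => /andP[].
have vA : v \in V :\: nbh v by rewrite !inE e_irr andbF vV.
have AV : V :\: nbh v \proper V.
  by rewrite properE subsetDl; apply/subsetPn; exists u => //; rewrite inE uN.
have := propV AV vA; rewrite /compat_at.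
have -> : V :\: nbh v :\: N v = V :\: nbh v :\ v.
  apply/setP=> x; rewrite !inE; case: eqP => //= _.
  by case: (e v x) => //=; case: (x \in V).
by rewrite /compat; case: (idim (_ :\ v)) => [?|] [].
Qed.

Lemma edge_dims u v d d' k k' : u \in V -> v \in V -> e u v ->
  dims u d d' -> dims v k k' -> k = d'.+1 /\ d = k'.+1.
Proof.
move=> uV vV uv tu tv; have nuv : u != v by apply: contraTneq uv => ->; rewrite e_irr.
by case: (dims_pair uV vV nuv tu tv) => [[_]|[_ [_ [_]]]] //; rewrite uv.
Qed.

Lemma nbh_neq0 v d d' : v \in V -> dims v d d' -> d <> d' -> nbh v != set0.
Proof.
move=> vV [v1 v2] dd'; apply/eqP=> N0; case: dd'.
suff E : V :\ v = V :\: N v by move: v2; rewrite -E v1 => -[].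
apply/setP=> x; rewrite !inE; case: eqP => //= _.
have : (x \in nbh v) = false by rewrite N0 inE.
by rewrite inE; case: (x \in V) => [/= ->|_]; rewrite ?andbF.
Qed.

Lemma level_exists v : v \in V -> ~ compat_at V v ->
  exists m, forall u, u \in V -> dims u m.+1 m.
Proof.
move=> vV nv; have [w wV] := clash_exists vV nv; rewrite /clash.
case w1: (idim (V :\ w)) => [d|//]; case w2: (idim (V :\: N w)) => [d'|//] /eqP dd'.
have allV u : u \in V -> exists k k', dims u k k'.
  by move=> uV; apply: dims_all wV uV (conj w1 w2) dd'.
(* If [w] has the wrong order, any neighbour of [w] has the right one, since an edge exchanges the
   roles. *)
have [x [k [k' [xV tx kk']]]] : exists x k k', [/\ x \in V, dims x k k' & (k' < k)%N].
  have [lt_d'd|le_dd'] := ltnP d' d; first by exists w, d, d'.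
  have /set0Pn[u] := nbh_neq0 wV (conj w1 w2) dd'; rewrite inE => /andP[uV wu].
  have [k [k' tu]] := allV u uV; exists u, k, k'.
  have [] := edge_dims wV uV wu (conj w1 w2) tu; split=> //; lia.
have [kE|nkE] := eqVneq k k'.+1.
  exists k' => u uV; have [->|] := eqVneq u x; first by rewrite -kE.
  rewrite eq_sym => xu.
  have [l [l' tu]] := allV u uV.
  have [[_ [lE l'E]]|[_ [lE [l'E _]]]] := dims_pair xV uV xu tx tu.
    have -> : k' = l' by lia.
    by move: tu; rewrite lE; congr (dims u _.+1 _); lia.
  by rewrite -kE -lE -l'E.
(* The two classes now differ in dimension. All neighbours of [y] have the dimensions of [x] and are
   pairwise equivalent, so [class_deletion] contradicts [nbh_deletion]. *)
have /set0Pn[y] : nbh x != set0 by apply: nbh_neq0 tx _ => //; lia.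
rewrite inE => /andP[yV xy]; have [l [l' ty]] := allV y yV.
have [lE kE] := edge_dims xV yV xy tx ty.
have yN : nbh y != set0 by apply/set0Pn; exists x; rewrite inE xV e_sym.
have dimsN u : u \in nbh y -> dims u k k'.
  rewrite inE => /andP[uV yu]; have [j [j' tu]] := allV u uV.
  have [jE lE'] := edge_dims yV uV yu ty tu.
  by have [-> ->] : k = j /\ k' = j' by lia.
have sN : nbh y \subset V by apply/subsetP=> u; rewrite inE => /andP[].
have := class_deletion kk' yN sN dimsN; rewrite nbh_deletion // => H.
have//: None = Some k; apply: H => u u' uN u'N; rewrite /eqv.
have [//|/= uu'] := eqVneq u u'.
have := dims_pair (subsetP sN _ uN) (subsetP sN _ u'N) uu' (dimsN _ uN) (dimsN _ u'N).
by case=> [[_ [kE' _]]|[->]] //; rewrite kE' eqxx in nkE.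
Qed.

(** * Both homology classes in the same dimension *)

Section Level.
Variable m : nat.
Hypothesis level : forall u, u \in V -> dims u m.+1 m.

Lemma eqv_refl u : eqv u u. Proof. by rewrite /eqv eqxx. Qed.

Lemma eqv_some u v : u \in V -> v \in V -> u != v -> eqv u v ->
  idim (V :\ u :\ v) = Some m.+1.
Proof.
move=> uV vV uv; rewrite /eqv (negPf uv) /= => uv'.
by case: (dims_pair uV vV uv (level uV) (level vV)) => [[idim0]|[]] //; rewrite idim0 in uv'.
Qed.

Lemma eqv_edge u v : u \in V -> v \in V -> e u v -> eqv u v = false.
Proof.
move=> uV vV uv; have nuv : u != v by apply: contraTneq uv => ->; rewrite e_irr.
rewrite /eqv (negPf nuv) /=.
by case: (dims_pair uV vV nuv (level uV) (level vV)) => [[->]|[_ [_ [_]]]] //; rewrite uv.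
Qed.

(** If all neighbours of [v] were equivalent, deleting them would leave a sphere by
    [class_deletion], yet it leaves [v] isolated. *)
Lemma noneqv_neighbours v : v \in V ->
  exists u u', [/\ u \in nbh v, u' \in nbh v & ~~ eqv u u'].
Proof.
move=> vV; have vN : nbh v != set0 by apply: nbh_neq0 (level vV) _ => //; lia.
have sN : nbh v \subset V by apply/subsetP=> u; rewrite inE => /andP[].
have [/existsP[u /existsP[u' /and3P[]]]|/existsPn no] :=
  boolP [exists u, exists u', [&& u \in nbh v, u' \in nbh v & ~~ eqv u u']].
  by exists u, u'.
have := class_deletion (ltnSn m) vN sN (fun u uN => level (subsetP sN u uN)).
rewrite nbh_deletion // => H; have//: None = Some m.+1; apply: H => u u' uN u'N.
by have /existsPn/(_ u') := no u; rewrite uN u'N /= negbK.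
Qed.

Lemma eqv_trans x a b : x \in V -> a \in V -> b \in V -> eqv a x -> eqv x b -> eqv a b.
Proof.
move=> xV aV bV ax xb.
have [//|nab] := boolP (eqv a b).
have ab : a != b by apply: contraNneq nab => ->; apply: eqv_refl.
have xa' : a != x by apply: contraNneq nab => ->.
have xb' : x != b by apply: contraNneq nab => <-.
have bx' : b != x by rewrite eq_sym.
have xa'' : x != a by rewrite eq_sym.
have ba : b != a by rewrite eq_sym.
have hax := eqv_some aV xV xa' ax; have hxb := eqv_some xV bV xb' xb.
have hab : idim (V :\ a :\ b) = None by move: nab; rewrite /eqv (negPf ab) negbK => /eqP.
have gA := good_proper (proper_rem aV).
have haxb : idim (V :\ a :\ x :\ b) = None.
  rewrite (rem_comm _ x b); apply: (good_rem_rem gA); rewrite ?hax ?hab ?(level aV).1 //.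
  - by rewrite !inE ba.
  - by rewrite !inE xa''.
(* If [a] and [b] are not equivalent, this set is a sphere. The rest shows it acyclic, from the edge
   [a b] or from [good_rem_rem] inside [V :\: N a]. *)
have hxbNa : idim (V :\ x :\ b :\: N a) = Some m.
  have : compat_at (V :\ x :\ b) a.
    apply: propV; last by rewrite !inE ab xa'.
    exact: sub_proper_trans (subsetDl _ _) (proper_rem xV).
  rewrite /compat_at hxb (rem_comm _ b a) (rem_comm _ x a) haxb /compat.
  by case: (idim _) => [k|] [] //= [->].
have nax : ~~ e a x by apply: contraTN ax => ax; rewrite (eqv_edge aV xV ax).
have hxNa : idim (V :\ x :\: N a) = None.
  have := compat_rem xV aV xa''; rewrite (rem_comm V x a) hax (level xV).1 /compat.
  by case: (idim _) => [k|] [].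
have [eab|neab] := boolP (e a b).
  by move: hxbNa; rewrite (remN_adj _ (etrans (e_sym b a) eab)) hxNa.
have hbNa : idim (V :\ b :\: N a) != None.
  have := compat_rem bV aV ba; rewrite (rem_comm V b a) hab (level bV).1 /compat.
  by case: (idim _) => [k|] [].
have gB := good_proper (proper_remN aV).
have : idim (V :\: N a :\ x :\ b) = None.
  apply: (good_rem_rem gB) => //.
  - by apply: mem_remN; rewrite // e_sym.
  - by apply: mem_remN; rewrite // e_sym.
  - by rewrite (level aV).2.
  - by rewrite -remN_comm.
  - by rewrite -remN_comm.
by rewrite -!remN_comm hxbNa.
Qed.

(** Let s be the sign of [V] minus one vertex. If no classes were shared, inclusion-exclusion along
    both edges would give -2s for [V] without the four ends, but a good set has value 0, 1 or -1. *)
Lemma edges_share x y a b : x \in V -> y \in V -> a \in V -> b \in V -> e x y -> e a b ->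
  [|| eqv x a, eqv x b, eqv y a | eqv y b].
Proof.
move=> xV yV aV bV xy ab; apply/negPn/negP=> /norP[nxa /norP[nxb /norP[nya nyb]]].
have sumE A : A \proper V -> ind_sum (-1) A = dim_sign (idim A).
  by move=> AV; apply: ind_sum_good; apply: good_proper.
have del1 u : u \in V -> ind_sum (-1) (V :\ u) = ((-1) ^+ m.+1)%R.
  by move=> uV; rewrite sumE ?proper_rem // (level uV).1.
have sub_rem u B : u \in V -> V :\ u :\: B \proper V.
  by move=> uV; apply: sub_proper_trans (subsetDl _ _) (proper_rem uV).
have del2 u v : u \in V -> ~~ eqv u v -> ind_sum (-1) (V :\ u :\ v) = 0%R.
  by move=> uV; rewrite negb_or negbK => /andP[_ /eqP E]; rewrite sumE ?sub_rem // E.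
have neq u v : ~~ eqv u v -> v != u.
  by rewrite eq_sym => /norP[].
have Exy u : u \in V -> ~~ eqv x u -> ~~ eqv y u ->
    ind_sum (-1) (V :\ x :\ y :\ u) = (- (-1) ^+ m.+1)%R.
  move=> uV nxu nyu.
  rewrite (rem_comm _ y u) (rem_comm _ x u) (ind_sum_edge _ _ _ xy).
  - by rewrite (rem_comm _ u x) (rem_comm _ u y) !del2 // del1 // addr0 sub0r.
  - by rewrite !inE eq_sym neq.
  - by rewrite !inE eq_sym neq.
have nxy : ~~ eqv x y by rewrite eqv_edge.
have : ind_sum (-1) (V :\ x :\ y :\ a :\ b) = (- (-1) ^+ m.+1 - (-1) ^+ m.+1)%R.
  rewrite (ind_sum_edge _ _ _ ab).
  - by rewrite !Exy // del2 // subr0.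
  - by rewrite !inE !neq.
  - by rewrite !inE !neq.
rewrite sumE; last first.
  by apply: sub_proper_trans (sub_rem x [set y] xV); rewrite setDDl subsetDl.
have := dim_sign_cases (idim (V :\ x :\ y :\ a :\ b)).
have : ((-1) ^+ m.+1 == 1 :> int)%R || ((-1) ^+ m.+1 == -1 :> int)%R.
  by rewrite -sqrf_eq1 sqrr_sign.
by case/orP=> /eqP->; case=> ->.
Qed.

Lemma level_cycle : V != set0 ->
  exists n, exists f : {ffun 'I_n -> T},
    [/\ 3 %| n, induced_cycle e f & forall i, f i \in V].
Proof.
move=> V0; have /set0Pn[b bV] := V0.
have [a [c [aN cN nac]]] := noneqv_neighbours bV.
have [aV ba] : a \in V /\ e b a by move: aN; rewrite inE => /andP.
have [cV bc] : c \in V /\ e b c by move: cN; rewrite inE => /andP.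
have trans := eqv_trans.
(* An edge from [w] to [u] must share a class with both edges [b a] and [b c]. If [w] is in none of
   the three classes, this puts every neighbour of [w] in the class of [b]. *)
have cover w : w \in V -> [|| eqv a w, eqv b w | eqv c w].
  move=> wV; apply/negPn/negP=> /norP[naw /norP[nbw ncw]].
  have b_nbr u : u \in nbh w -> eqv b u.
    rewrite inE => /andP[uV wu]; apply/negPn/negP=> nbu.
    have := edges_share bV aV wV uV ba wu; have := edges_share bV cV wV uV bc wu.
    rewrite (negPf nbw) (negPf naw) (negPf ncw) (negPf nbu) /= => cu au.
    by move: nac; rewrite (trans u) // eqvC.
  have [u [u' [uN u'N]]] := noneqv_neighbours wV.
  have uV : u \in V by move: uN; rewrite inE => /andP[].
  have u'V : u' \in V by move: u'N; rewrite inE => /andP[].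
  by rewrite (trans b) ?b_nbr // eqvC b_nbr.
pose col w := if eqv a w then 0%N else if eqv b w then 1%N else 2%N.
have col_eqv u w : u \in V -> w \in V -> col u = col w -> eqv u w.
  move=> uV wV; rewrite /col; have := cover u uV; have := cover w wV.
  have tr z : z \in V -> eqv z u -> eqv z w -> eqv u w.
    by move=> zV zu zw; apply: (trans z); rewrite // eqvC.
  case au: (eqv a u); case aw: (eqv a w) => /=;
    [by move=> *; apply: (tr a) | by case: ifP | by case: ifP |].
  case bu: (eqv b u); case bw: (eqv b w) => //= cw cu _; first exact: (tr b).
  exact: (tr c).
have col_edge u w : u \in V -> w \in V -> e u w -> col u != col w.
  by move=> uV wV uw; apply: contraFneq (eqv_edge uV wV uw); apply: col_eqv.
have col_lt3 w : col w < 3 by rewrite /col; do 2?case: ifP.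
apply: (induced_directed_cycle e_sym col_lt3) => // w wV.
(* The neighbours [u] and [u'] take the two colours other than that of [w], so one of them has the
   next colour. *)
have [u [u' [uN u'N nuu']]] := noneqv_neighbours wV.
have [uV wu] : u \in V /\ e w u by move: uN; rewrite inE => /andP.
have [u'V wu'] : u' \in V /\ e w u' by move: u'N; rewrite inE => /andP.
have cuu' : col u != col u' by apply: contraNneq nuu'; apply: col_eqv.
have [cu|cu] := eqVneq (col u) ((col w).+1 %% 3); first by exists u.
exists u'; split=> //; apply: (third_color _ _ _ _ _ cuu' cu); rewrite ?col_lt3 //.
  exact: col_edge.
exact: col_edge.
Qed.

End Level.
End Bad.

(** * Ternary vertex sets *)

Lemma ternary_good V :
  (forall n (f : {ffun 'I_n -> T}), 3 %| n -> induced_cycle e f ->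
     ~ (forall i, f i \in V)) -> good V.
Proof.
move: {2}#|V| (leqnn #|V|) => n; elim: n V => [|n IHn] V Vn tV A v AV vA.
  by have := subset_leq_card AV; have := card_rem vA; lia.
have [AVp|nAVp] := boolP (A \proper V).
  have gA : good A; last by apply: gA.
  apply: IHn; first by rewrite -ltnS; apply: leq_trans (proper_card AVp) Vn.
  by move=> k f k3 cf fA; apply: (tV k f k3 cf) => i; apply: (subsetP AV).
have AVe : A = V by apply/eqP; rewrite eqEproper AV nAVp.
rewrite {}AVe in vA AV nAVp *.
have prop B w : B \proper V -> w \in B -> compat_at B w.
  move=> BV wB; have gB : good B; last by apply: gB.
  apply: IHn; first by rewrite -ltnS; apply: leq_trans (proper_card BV) Vn.
  by move=> k f k3 cf fB; apply: (tV k f k3 cf) => i; apply: (subsetP (proper_sub BV)).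
have [//|ntri] := compat_dec (idim V) (idim (V :\ v)) (idim (V :\: N v)).
have [m level] := level_exists prop vA ntri.
have [|k [f [k3 cf fV]]] := level_cycle prop level; first by apply/set0Pn; exists v.
by case: (tV k f k3 cf).
Qed.

(** Both sides expand at a vertex of [D], and the triangle inequality compares them. Deleting its
    closed neighbourhood may also shrink the rest, hence an arbitrary subset [C] of [V]. *)
Lemma ind_sum_bound (V C D : {set T}) : good V -> C \subset V ->
  (`|ind_sum (-1) (C :|: D)| <= ind_sum 1 D)%R.
Proof.
move=> gV; move: {2}#|D| (leqnn #|D|) => n; elim: n C D => [|n IHn] C D.
  rewrite leqn0 cards_eq0 => /eqP-> CV; rewrite setU0 ind_sum0.
  rewrite ind_sum_good; last exact: goodS gV.
  by case: (dim_sign_cases (idim C)) => ->.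
move=> Dn CV; have [->|/set0Pn[v vD]] := eqVneq D set0.
  rewrite setU0 ind_sum0 ind_sum_good; last exact: goodS gV.
  by case: (dim_sign_cases (idim C)) => ->.
have vCD : v \in C :|: D by rewrite inE vD orbT.
rewrite (ind_sum_rec _ vCD) (ind_sum_rec _ vD) mul1r mulN1r.
apply: le_trans (ler_normB _ _) _; apply: lerD.
  have -> : (C :|: D) :\ v = (C :\ v) :|: (D :\ v) by rewrite setDUl.
  apply: IHn; first by rewrite -ltnS; apply: leq_trans (card_rem vD) Dn.
  exact: subset_trans (subsetDl _ _) CV.
rewrite setDUl; apply: IHn; first by rewrite -ltnS; apply: leq_trans (card_remN vD) Dn.
exact: subset_trans (subsetDl _ _) CV.
Qed.

Lemma ind_countE D : ((ind_count e D)%:Z = ind_sum 1 D)%R.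
Proof.
rewrite /ind_count -sum1_card /ind_sum -natz natr_sum.
by apply: eq_big => [S|S _]; rewrite ?inE // expr1n.
Qed.

Lemma indep_polyE : (indep_poly e).[-1]%R = ind_sum (-1) setT.
Proof.
rewrite /indep_poly horner_sum; apply: eq_big => [S|S _]; first by rewrite subsetT.
by rewrite hornerXn.
Qed.

Lemma decycling_good D : decycling e D -> good (~: D).
Proof.
move=> /existsPn dD; apply: ternary_good => n f n3 cf fD.
have n_le : n < #|T|.+1.
  have /andP[/andP[_ /injectiveP inj] _] := cf.
  by rewrite ltnS -[n]card_ord; apply: leq_card inj.
have /existsPn/(_ f) := dD (Ordinal n_le); rewrite n3 cf /=.
by apply/negP; rewrite negbK; apply/forallP=> i; have := fD i; rewrite inE.
Qed.

Lemma indep_poly_bound D : decycling e D ->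
  (`|(indep_poly e).[-1]| <= (ind_count e D)%:Z)%R.
Proof.
move=> /decycling_good gD; rewrite indep_polyE ind_countE -(setUCr D) setUC.
exact: ind_sum_bound gD (subxx _).
Qed.

Lemma ind_count_le D : ind_count e D <= 2 ^ #|D|.
Proof.
rewrite -card_powerset; apply: subset_leq_card; apply/subsetP=> S.
by rewrite !inE => /andP[].
Qed.

End Graph.

Theorem theorem2p1 (T : finType) (e : rel T)
    (e_sym : symmetric e) (e_irr : irreflexive e) :
  (`|(indep_poly e).[-1]| <= (min_ind_decycling e)%:Z)%R /\
  (min_ind_decycling e <= 2 ^ phi3 e)%N.
Proof.
have dT : decycling e [set: T].
  apply/existsPn=> n; apply/existsPn=> f; apply/negP=> /and3P[_ cf /forallP fT].
  have n0 : 0 < n by case/andP: cf => /andP[n3 _] _; apply: leq_trans n3.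
  by have := fT (Ordinal n0); rewrite inE.
split.
  rewrite /min_ind_decycling; elim/big_ind: _ => [|x y|D /indep_poly_bound]; last exact.
    (* The default [2 ^ #|T|] of the minimum is handled by the decycling set of all vertices. *)
    apply: le_trans (indep_poly_bound e_sym e_irr dT) _.
    by rewrite lez_nat; have := ind_count_le e [set: T]; rewrite cardsT.
  by move=> hx hy; rewrite /minn; case: ifP.
rewrite /phi3; elim/big_ind: _ => [|x y hx hy|D dD].
(* The default [#|T|] of [phi3] matches the default [2 ^ #|T|] of the other minimum. *)
- by rewrite /min_ind_decycling; elim/big_rec: _ => // D y _; apply: leq_trans (geq_minr _ _).
- by rewrite /minn; case: ifP.
apply: leq_trans (ind_count_le e D).
by apply: bigminn_le_cond; rewrite ?mem_index_enum.
Qed.
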